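(* Let $1\le s,q,r<\infty$ with $q<s$ and $r\le s$. For every Banach space $X$, $$\ell_{q}(X) \stackrel{1}{\hookrightarrow}\ell_{(s,q,r)}^{A}(X)\stackrel{1}{\hookrightarrow} \ell_q^w(X).$$
   Context: Banach spaces are over $\mathbb{K}=\mathbb{R}$ or $\mathbb{C}$; $B_X$ is the closed unit ball of $X$ and $X^*$ its topological dual. $\ell_p(X)$ is the space of absolutely $p$-summable $X$-valued sequences with its usual norm $\|\cdot\|_p$. $\ell_p^w(X)$ is the space of weakly $p$-summable $X$-valued sequences with norm $\|(x_j)_j\|_{w,p}=\sup_{x^*\in B_{X^*}}\|(x^*(x_j))_{j=1}^\infty\|_p$. The space $\ell^{A}_{(s,q,r)}(X)$ of anisotropic $(s,q,r)$-summable sequences consists of all sequences $(x_j)_{j=1}^\infty$ in $X$ such that $\sum_{j=1}^\infty\left(\sum_{k=1}^\infty|x_k^*(x_j)|^s\right)^{q/s}<\infty$ for every $(x_k^* )_{k=1}^\infty\in\ell_r(X^* )$, with the norm $$\|(x_j)_{j=1}^\infty\|_{A(s,q,r)}=\sup_{(x_k^* )_k\in B_{\ell_r(X^* )}}\left(\sum_{j=1}^\infty\left(\sum_{k=1}^\infty|x_k^*(x_j)|^s\right)^{q/s}\right)^{1/q}.$$ For normed spaces, $E\stackrel{1}{\hookrightarrow}F$ means that $E$ is a linear subspace of $F$ and $\|x\|_F\le\|x\|_E$ for every $x\in E$. *)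

(* Defs.v *)
From HB Require Import structures.
From mathcomp Require Import all_boot all_order all_algebra.
From mathcomp Require Import all_classical all_reals all_analysis.
From mathcomp.real_closed Require Import complex.

Set Implicit Arguments.
Unset Strict Implicit.
Unset Printing Implicit Defensive.

Import Order.TTheory GRing.Theory Num.Theory.
Import numFieldNormedType.Exports.

Local Open Scope classical_set_scope.
Local Open Scope ring_scope.
Local Open Scope ereal_scope.

Variant scalars := RealScalars | ComplexScalars.

Definition scalar_field (R : realType) (k : scalars) : numFieldType :=
  match k with
  | RealScalars => R
  | ComplexScalars => R[i]
  end.

Definition real_part (R : realType) (k : scalars) : scalar_field R k -> R :=
  match k return scalar_field R k -> R with
  | RealScalars => fun a => a
  | ComplexScalars => @complex.Re R
  end.

Section spaces.
Context {R : realType} {k : scalars}.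
Local Notation K := (scalar_field R k).

(* The library's norm on a normed module over [K] takes its values in [K]
   (nonnegative elements, hence real ones); [enorm] reads it in [R]. *)
Definition enorm (V : normedModType K) (x : V) : \bar R := (real_part `|x|)%:E.

Section lp.
Context {T : Type} (N : T -> \bar R) (p : R).

Definition lp_norm (x : nat -> T) : \bar R := 'N[counting]_(p%:E)[N \o x].

Definition lp : set (nat -> T) := [set x | lp_norm x < +oo].

End lp.

Section dual.
Context {X : normedModType K}.

Definition dual : Type := {f : {linear X -> K^o} | continuous f}.

Definition dual_fun (f : dual) : X -> K^o := sval f.

Definition dual_norm (f : dual) : \bar R :=
  ereal_sup [set enorm (dual_fun f x) | x in [set x : X | enorm x <= 1]].

End dual.
Arguments dual : clear implicits.

Coercion dual_fun : dual >-> Funclass.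

Section summable_sequences.
Context {X : normedModType K}.

Definition weak_lp_norm (p : R) (x : nat -> X) : \bar R :=
  ereal_sup [set lp_norm (@enorm K^o) p (fun j => f (x j)) |
             f in [set f : dual X | dual_norm f <= 1]].

Definition weak_lp (p : R) : set (nat -> X) :=
  [set x | forall f : dual X, lp (@enorm K^o) p (fun j => f (x j))].

Definition aniso_sum (s q : R) (f : nat -> dual X) (x : nat -> X) : \bar R :=
  \sum_(j <oo) (\sum_(k <oo) enorm (f k (x j)) `^ s) `^ (q / s).

Definition aniso_norm (s q r : R) (x : nat -> X) : \bar R :=
  ereal_sup [set aniso_sum s q f x `^ q^-1 |
             f in [set f : nat -> dual X | lp_norm dual_norm r f <= 1]].

Definition aniso (s q r : R) : set (nat -> X) :=
  [set x | forall f : nat -> dual X, lp dual_norm r f -> aniso_sum s q f x < +oo].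

End summable_sequences.

Definition linear_subspace (V : lmodType K) (E : set V) : Prop :=
  submod_closed [pred x in E].

(* Norms are extended-real valued, being defined by sums and suprema; the
   finiteness clause makes the last one a comparison of real numbers. *)
Definition embeds1 (V : lmodType K) (E : set V) (NE : V -> \bar R)
    (F : set V) (NF : V -> \bar R) : Prop :=
  [/\ linear_subspace E, linear_subspace F, E `<=` F,
      forall x, E x -> NE x < +oo &
      forall x, E x -> NF x <= NE x].

End spaces.
Arguments dual {R k} X.

(* Main.v *)
(* For [l_q] in [aniso], use [|f (x)| <= |f| |x|] and the inclusion of [l_r] in
   [l_s]. For [aniso] in [l_q^w], test against [(f, 0, 0, ...)]. Finiteness of
   the anisotropic norm is a gliding-hump argument: unit-ball witnesses [f n]
   of unboundedness, scaled by [2 ^- n.+1] and merged into one sequence, would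
   make a single anisotropic sum infinite. *)
Require Import Defs.
From mathcomp Require Import all_boot all_order all_algebra.
From mathcomp Require Import all_classical all_reals all_analysis.
From mathcomp.real_closed Require Import complex.

Set Implicit Arguments.
Unset Strict Implicit.
Unset Printing Implicit Defensive.

Import Order.TTheory GRing.Theory Num.Theory.
Import numFieldNormedType.Exports.

Local Open Scope classical_set_scope.
Local Open Scope ring_scope.
Local Open Scope ereal_scope.

(** * Powers and series of nonnegative extended reals *)

Section powers_and_series.
Context {R : realType}.
Implicit Types (x y : \bar R) (p r s : R) (a b : nat -> \bar R).

Lemma poweR_le p x y : (0 <= p)%R -> 0 <= x -> x <= y -> x `^ p <= y `^ p.
Proof.
move=> p0 x0 xy; apply: gt0_ler_poweR => //; rewrite in_itv/= ?x0 ?leey//.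
by rewrite (le_trans x0 xy).
Qed.

Lemma EFin_powR_ge0 (u : R) p : 0 <= (u `^ p)%:E.
Proof. by rewrite lee_fin powR_ge0. Qed.

Lemma poweRVK p x : p != 0%R -> 0 <= x -> (x `^ p) `^ p^-1 = x.
Proof. by move=> p0 x0; rewrite -poweRrM divff// poweRe1. Qed.

Lemma poweRKV p x : p != 0%R -> 0 <= x -> (x `^ p^-1) `^ p = x.
Proof. by move=> p0 x0; rewrite -poweRrM mulVf// poweRe1. Qed.

Lemma poweR_div t p x : t != 0%R -> (x `^ t) `^ (p / t) = x `^ p.
Proof. by move=> t0; rewrite -poweRrM mulrCA mulfV ?mulr1. Qed.

(** If [x <= y] then [x + y <= 2 * y], and [2 ^ p] factors out. The constant is crude, but the bound
    covers exponents below 1, such as [q / s], and only finiteness is at stake where it is used. *)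
Lemma poweRD_le p x y : (0 <= p)%R -> 0 <= x -> 0 <= y ->
  (x + y) `^ p <= (2 `^ p)%:E * (x `^ p + y `^ p).
Proof.
move=> p0; wlog xy : x y / x <= y => [H x0 y0|x0 y0].
  case: (leP x y) => [xy|/ltW yx]; first exact: H.
  by rewrite addeC (addeC (x `^ p)); exact: H.
have -> : (2 `^ p)%:E = 2%:E `^ p by [].
apply: (@le_trans _ _ ((2%:E * y) `^ p)).
  by apply: poweR_le; rewrite ?adde_ge0// mule_natl mule2n leeD2r.
rewrite poweRM//; apply: lee_wpmul2l; first exact: poweR_ge0.
by rewrite leeDr// poweR_ge0.
Qed.

Lemma nneseries_term_le a n : (forall k, 0 <= a k) -> a n <= \sum_(k <oo) a k.
Proof.
move=> a0; apply: le_trans (nneseries_lim_ge n.+1 _); last by move=> *.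
by rewrite big_nat_recr//= leeDr// sume_ge0.
Qed.

Lemma nneseries_single a : (forall k, 0 <= a k) -> (forall k, a k.+1 = 0) ->
  \sum_(k <oo) a k = a 0%N.
Proof.
move=> a0 aS; rewrite nneseries_recl// eseries0 ?adde0//.
by move=> [|k].
Qed.

(** The comparison behind closure under [c *: u + v], for both the strong and the anisotropic
    sequence spaces. *)
Lemma nneseries_lin_lty (c d : R) a b u : (0 <= c)%R -> (0 <= d)%R ->
  (forall k, 0 <= a k) -> (forall k, 0 <= b k) -> (forall k, 0 <= u k) ->
  (forall k, u k <= c%:E * a k + d%:E * b k) ->
  \sum_(k <oo) a k < +oo -> \sum_(k <oo) b k < +oo -> \sum_(k <oo) u k < +oo.
Proof.
move=> c0 d0 a0 b0 u0 uab aoo boo.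
apply: (@le_lt_trans _ _ (\sum_(k <oo) (c%:E * a k + d%:E * b k))).
  exact: lee_nneseries.
rewrite nneseriesD//; do ?by move=> *; rewrite mule_ge0.
rewrite !nneseriesZl//.
by rewrite lte_add_pinfty// lte_mul_pinfty.
Qed.

(* With [S] the sum of the [a k], each term satisfies [a k ^ t <= a k * S ^ (t - 1)]. *)
Lemma nneseries_powR_le (t : R) a : (1 <= t)%R -> (forall k, 0 <= a k) ->
  \sum_(k <oo) a k `^ t <= (\sum_(k <oo) a k) `^ t.
Proof.
move=> t1 a0; have t0 : (0 < t)%R by exact: lt_le_trans t1.
set S := \sum_(k <oo) a k.
have S0 : 0 <= S by exact: nneseries_ge0.
have split_t x : 0 <= x -> x `^ t = x `^ (t - 1) * x.
  move=> x0; rewrite -{3}(poweRe1 x0) -poweRD ?subrK//.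
  by apply: add_neq0_poweRD_def; rewrite subrK gt_eqF.
have [Soo|] := ltP S +oo; last first.
  by rewrite leye_eq => /eqP ->; rewrite poweRyr ?gt_eqF// leey.
have Sfin : S `^ (t - 1) \is a fin_num.
  by rewrite ge0_fin_numE ?poweR_ge0// poweR_lty.
apply: (@le_trans _ _ (\sum_(k <oo) (fine (S `^ (t - 1)))%:E * a k)).
  apply: lee_nneseries => [k _ _|k _]; first exact: poweR_ge0.
  rewrite fineK// split_t// lee_wpmul2r// poweR_le ?subr_ge0//.
  exact: nneseries_term_le.
by rewrite nneseriesZl// fineK// [leRHS]split_t.
Qed.

(** This is the norm-one inclusion of l_r in l_s, raised to the power [s]: the previous lemma
    applied to the terms [a k ^ r] with exponent [s / r >= 1]. *)
Lemma nneseries_powR_anti r s a : (0 < r)%R -> (r <= s)%R ->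
  (forall k, 0 <= a k) ->
  \sum_(k <oo) a k `^ s <= (\sum_(k <oo) a k `^ r) `^ (s / r).
Proof.
move=> r0 rs a0.
have -> : \sum_(k <oo) a k `^ s = \sum_(k <oo) (a k `^ r) `^ (s / r).
  apply: eq_eseriesr => k _.
  by rewrite poweR_div// gt_eqF.
apply: nneseries_powR_le; first by rewrite ler_pdivlMr// mul1r.
by move=> k; exact: poweR_ge0.
Qed.

(** Nonnegative series are unordered sums over sets, so they may be reindexed along [e] and then
    summed by blocks. *)
Lemma nneseries_pair (e : nat -> nat * nat) (u : nat -> nat -> \bar R) :
  set_bij setT setT e -> (forall n k, 0 <= u n k) ->
  \sum_(m <oo) u (e m).1 (e m).2 = \sum_(n <oo) \sum_(k <oo) u n k.
Proof.
move=> be u0.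
rewrite nneseries_esumT// -(reindex_esum _ _ _ (fun nk => u nk.1 nk.2) be).
rewrite [RHS]nneseries_esumT; last by move=> n; exact: nneseries_ge0.
under [RHS]eq_esum do rewrite nneseries_esumT//.
rewrite esum_esum//; congr esum.
by apply/seteqP; split => -[].
Qed.

Lemma nat_pair_bij : exists e : nat -> nat * nat, set_bij setT setT e.
Proof. by have /card_esym/card_set_bijP := card_nat2. Qed.

End powers_and_series.

(** * Reading nonnegative scalars as real numbers *)

Section real_parts.
Context {R : realType} {k : scalars}.
Local Notation K := (scalar_field R k).
Implicit Types a b : K.

Lemma real_part_le a b : (a <= b)%R -> (real_part a <= real_part b)%R.
Proof. by case: k a b => //= a b; rewrite lecE => /andP[]. Qed.

Lemma real_part0 : real_part (0%R : K) = 0%R.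
Proof. by case: k. Qed.

Lemma real_part1 : real_part (1%R : K) = 1%R.
Proof. by case: k. Qed.

Lemma real_part_ge0 a : (0 <= a)%R -> (0 <= real_part a)%R.
Proof. by move=> a0; rewrite -real_part0 real_part_le. Qed.

Lemma real_partD a b : real_part (a + b)%R = (real_part a + real_part b)%R.
Proof. by case: k a b => //= -[? ?] [? ?]. Qed.

(** In the complex order, [0 <= a] forces the imaginary part of [a] to vanish, so the cross term of
    the product drops out. *)
Lemma real_partM a b : (0 <= a)%R ->
  real_part (a * b)%R = (real_part a * real_part b)%R.
Proof.
case: k a b => //= -[a1 a2] [b1 b2].
by rewrite lecE /= => /andP[/eqP -> _]; rewrite mul0r subr0.
Qed.

Lemma real_part_nat n : real_part (n%:R : K) = n%:R%R.
Proof.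
by elim: n => [|n IH]; rewrite ?real_part0// -natr1 real_partD IH real_part1 natr1.
Qed.

Lemma real_part_natV n : real_part (n.+1%:R^-1 : K) = (n.+1%:R^-1)%R.
Proof.
apply: (@mulfI _ n.+1%:R); first by rewrite pnatr_eq0.
by rewrite -{1}real_part_nat -real_partM// !mulfV ?real_part1// pnatr_eq0.
Qed.

End real_parts.

(** * The norm axioms for [enorm] *)

Section enorm_theory.
Context {R : realType} {k : scalars} {V : normedModType (scalar_field R k)}.
Local Notation K := (scalar_field R k).
Implicit Types x y : V.

Lemma enorm_ge0 x : 0 <= enorm x.
Proof. by rewrite lee_fin real_part_ge0. Qed.

Lemma enorm0 : enorm (0%R : V) = 0.
Proof. by rewrite /enorm normr0 real_part0. Qed.

Lemma enormD x y : enorm (x + y)%R <= enorm x + enorm y.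
Proof. by rewrite -EFinD lee_fin -real_partD real_part_le// ler_normD. Qed.

Lemma enormZ (c : K) x : enorm (c *: x)%R = (real_part `|c|%R)%:E * enorm x.
Proof. by rewrite /enorm normrZ -EFinM real_partM. Qed.

End enorm_theory.

(** * The dual space and its norm *)

Section dual_theory.
Context {R : realType} {k : scalars} {X : normedModType (scalar_field R k)}.
Local Notation K := (scalar_field R k).
Implicit Types f : dual X.

Lemma dual_norm_ub f x : enorm x <= 1 -> enorm (dual_fun f x) <= dual_norm f.
Proof. by move=> x1; apply: ereal_sup_ubound; exists x. Qed.

Lemma dual_norm_le f C : (forall x, enorm x <= 1 -> enorm (dual_fun f x) <= C) ->
  dual_norm f <= C.
Proof. by move=> fC; apply: ge_ereal_sup => _ [x x1 <-]; exact: fC. Qed.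

Lemma dual_norm_ge0 f : 0 <= dual_norm f.
Proof.
apply: le_trans (dual_norm_ub f (x := 0%R) _); first exact: enorm_ge0.
by rewrite enorm0.
Qed.

Lemma dual_norm_lty f : dual_norm f < +oo.
Proof.
(* A continuous linear map is bounded. The bound [M] lives in [K]; its positivity makes [real_part]
   multiplicative on [M * |x|]. *)
have [M M0 fM] : exists2 M : K, (0 < M)%R &
    forall x, (`|dual_fun f x| <= M * `|x|)%R.
  apply: pinfty_ex_gt0; apply/linear_boundedP/linear_bounded_continuous.
  exact: (svalP f).
apply: (@le_lt_trans _ _ (real_part M)%:E); last by rewrite ltry.
apply: dual_norm_le => x; rewrite !lee_fin => x1.
apply: le_trans (real_part_le (fM x)) _.
by rewrite real_partM ?(ltW M0)// ler_piMr// real_part_ge0// ltW.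
Qed.

Lemma enorm_dual_le f x : enorm (dual_fun f x) <= dual_norm f * enorm x.
Proof.
have [->|x0] := eqVneq x 0%R.
  by rewrite /dual_fun linear0 !enorm0 mule0.
have nx0 : `|x|%R != 0%R by rewrite normr_eq0.
(* Normalise [x], since the dual norm only sees the unit ball, and restore the factor by
   homogeneity. *)
set y := (`|x|^-1 *: x)%R.
have -> : dual_fun f x = (`|x| *: dual_fun f y)%R.
  by rewrite /dual_fun /y linearZ scalerA mulfV// scale1r.
rewrite enormZ normr_id muleC lee_wpmul2r ?enorm_ge0//.
apply: dual_norm_ub.
by rewrite /enorm normrZ normfV normr_id mulVf// real_part1.
Qed.

Definition dual0 : dual X :=
  exist _ (\0 : {linear X -> K^o})%R (@cst_continuous X K^o 0%R).

Lemma dual_scale_subproof (c : K) f : continuous (c \*: sval f)%R.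
Proof. by move=> x; apply: cvgZ; [exact: cvg_cst|exact: (svalP f)]. Qed.

Definition dual_scale (c : K) f : dual X :=
  exist _ (c \*: sval f : {linear X -> K^o})%R (@dual_scale_subproof c f).

Lemma dual_norm0 : dual_norm dual0 = 0.
Proof.
apply/eqP; rewrite eq_le dual_norm_ge0 andbT.
by apply: dual_norm_le => x _; rewrite enorm0.
Qed.

Lemma dual_norm_scale_le c f :
  dual_norm (dual_scale c f) <= (real_part `|c|%R)%:E * dual_norm f.
Proof.
apply: dual_norm_le => x x1; rewrite [dual_fun _ _]/= enormZ.
by rewrite lee_wpmul2l ?lee_fin ?real_part_ge0// dual_norm_ub.
Qed.

End dual_theory.

(** * The l_p norm as a series *)

Section lp_theory.
Context {R : realType} {T : Type} (N : T -> \bar R) (p : R).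
Hypotheses (N0 : forall t, 0 <= N t) (p0 : (0 < p)%R).
Implicit Types x : nat -> T.

(** Integration against the counting measure is summation, and [N] is nonnegative, so the absolute
    value in the L^p norm disappears. *)
Lemma lp_normE x : lp_norm N p x = (\sum_(k <oo) N (x k) `^ p) `^ p^-1.
Proof.
rewrite /lp_norm Lnorm_counting//; congr (_ `^ _).
by apply: eq_eseriesr => k _; rewrite gee0_abs//; exact: N0.
Qed.

Lemma lp_norm_powR x : lp_norm N p x `^ p = \sum_(k <oo) N (x k) `^ p.
Proof.
rewrite lp_normE poweRKV ?gt_eqF// nneseries_ge0// => *.
exact: poweR_ge0.
Qed.

Lemma lpE x : lp N p x = (\sum_(k <oo) N (x k) `^ p < +oo) :> Prop.
Proof.
rewrite /lp/= lp_normE; apply/propext; split; last exact: poweR_lty.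
by apply: lty_poweRy; rewrite invr_neq0// gt_eqF.
Qed.

Lemma lp_norm_le1 x :
  (lp_norm N p x <= 1) = (\sum_(k <oo) N (x k) `^ p <= 1).
Proof.
rewrite lp_normE; set S := \sum_(k <oo) _.
have S0 : 0 <= S by apply: nneseries_ge0 => *; exact: poweR_ge0.
apply/idP/idP => S1.
  rewrite -(poweRKV (p := p) _ S0) ?gt_eqF// -(poweR1r p).
  by rewrite poweR_le ?poweR_ge0// ltW.
by rewrite -(poweR1r p^-1) poweR_le// invr_ge0 ltW.
Qed.

End lp_theory.

(** * Strongly summable sequences form a subspace *)

Section subspaces.
Context {R : realType} {k : scalars}.

Lemma linear_subspaceP (V : lmodType (scalar_field R k)) (E : set V) : E 0%R ->
  (forall c u v, E u -> E v -> E (c *: u + v)%R) -> linear_subspace E.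
Proof.
move=> E0 Elin; split; first exact: mem_set.
by move=> c u v Eu Ev; apply/mem_set/Elin; exact: set_mem.
Qed.

Context {X : normedModType (scalar_field R k)}.

Lemma lp_submod (p : R) : (0 < p)%R ->
  linear_subspace (lp (@enorm R k X) p).
Proof.
move=> p0; have lpX := lpE (@enorm_ge0 R k X) p0; apply: linear_subspaceP.
  rewrite lpX eseries0 ?ltry// => j _ _.
  by rewrite enorm0 poweR0r// gt_eqF.
move=> c u v; rewrite !lpX.
have C0 : (0 <= 2 `^ p :> R)%R by exact: powR_ge0.
(* The coefficients are those of |cu + v|^p <= 2^p |c|^p |u|^p + 2^p |v|^p. *)
apply: (nneseries_lin_lty (mulr_ge0 C0 (powR_ge0 (real_part `|c|%R) p)) C0);
  do ?by move=> j; exact: poweR_ge0.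
have c0 : 0 <= (real_part `|c|%R)%:E by rewrite lee_fin real_part_ge0.
move=> j; rewrite EFinM -muleA -[X in _ * (X * _)]poweR_EFin.
rewrite -[X in _ * X + _]poweRM ?enorm_ge0// -enormZ -ge0_muleDr ?poweR_ge0//.
apply: le_trans (poweRD_le (ltW p0) (enorm_ge0 _) (enorm_ge0 _)).
by apply: poweR_le; rewrite ?(ltW p0) ?enorm_ge0//; exact: enormD.
Qed.

End subspaces.

(** * Anisotropic sequences: linear structure, then the embedding of l_q *)

Section aniso_theory.
Context {R : realType} {k : scalars} {X : normedModType (scalar_field R k)}.
Variables (s q r : R).
Hypotheses (q1 : (1 <= q)%R) (r1 : (1 <= r)%R) (qs : (q < s)%R) (rs : (r <= s)%R).
Implicit Types (x : nat -> X) (f : nat -> dual X).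

Let q0 : (0 < q)%R. Proof. exact: lt_le_trans q1. Qed.
Let r0 : (0 < r)%R. Proof. exact: lt_le_trans r1. Qed.
Let s0 : (0 < s)%R. Proof. exact: lt_trans qs. Qed.
Let qs0 : (0 < q / s)%R. Proof. exact: divr_gt0. Qed.

Let inner_sum_ge0 f (y : X) : 0 <= \sum_(i <oo) enorm (dual_fun (f i) y) `^ s.
Proof. by apply: nneseries_ge0 => *; exact: poweR_ge0. Qed.

Lemma aniso_sum_ge0 f x : 0 <= aniso_sum s q f x.
Proof. by apply: nneseries_ge0 => *; exact: poweR_ge0. Qed.

Lemma aniso_submod : linear_subspace (@aniso R k X s q r).
Proof.
apply: linear_subspaceP.
  move=> f _; rewrite /aniso_sum eseries0 ?ltry// => j _ _.
  rewrite eseries0 ?poweR0r ?gt_eqF// => i _ _.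
  by rewrite /dual_fun linear0 enorm0 poweR0r// gt_eqF.
move=> c u v Au Av f lf; move: (Au f lf) (Av f lf).
pose C : R := (2 `^ s)%R.
have C0 : (0 <= C)%R by exact: powR_ge0.
(* [poweRD_le] is used twice: inside, at exponent [s], it costs [C], which the outer power turns
   into [C ^ (q / s)]; outside, at exponent [q / s], it costs the other factor. *)
pose D : R := (2 `^ (q / s) * (C `^ (q / s)))%R.
have D0 : (0 <= D)%R by rewrite mulr_ge0 ?powR_ge0.
pose c' : R := (real_part `|c|)%R.
have c'0 : (0 <= c')%R by exact: real_part_ge0.
pose S (w : nat -> X) j :=
  (\sum_(i <oo) enorm (dual_fun (f i) (w j)) `^ s) `^ (q / s).
have S0 w j : 0 <= S w j by exact: poweR_ge0.
have Dc0 : (0 <= D * (c' `^ s) `^ (q / s))%R by rewrite mulr_ge0// powR_ge0.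
apply: (@nneseries_lin_lty _ _ _ (S u) (S v) (S (c *: u + v)%R) Dc0 D0
  (S0 u) (S0 v) (S0 _)).
rewrite /S; move=> j; set U := \sum_(i <oo) enorm (dual_fun (f i) (u j)) `^ s.
set V := \sum_(i <oo) enorm (dual_fun (f i) (v j)) `^ s.
have U0 : 0 <= U by exact: inner_sum_ge0.
have V0 : 0 <= V by exact: inner_sum_ge0.
have cU0 : 0 <= (c' `^ s)%:E * U by exact: mule_ge0 (EFin_powR_ge0 _ _) U0.
(* Inner splitting first, term by term in [i]; the outer power of the sum is split afterwards. *)
apply: (@le_trans _ _ ((C%:E * ((c' `^ s)%:E * U + V)) `^ (q / s))).
  apply: poweR_le; rewrite ?(ltW qs0)//.
  rewrite -nneseriesZl; last by move=> *; exact: poweR_ge0.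
  rewrite -nneseriesD; do ?by move=> *; rewrite ?mule_ge0 ?poweR_ge0// EFin_powR_ge0.
  rewrite -nneseriesZl; last first.
    by move=> *; rewrite adde_ge0 ?mule_ge0 ?poweR_ge0// EFin_powR_ge0.
  apply: lee_nneseries => [i _ _|i _]; first exact: poweR_ge0.
  have c'E0 : 0 <= c'%:E by rewrite lee_fin.
  rewrite -[X in _ * (X * _ + _)]poweR_EFin -poweRM ?enorm_ge0// -enormZ.
  apply: le_trans (poweRD_le (ltW s0) (enorm_ge0 _) (enorm_ge0 _)).
  apply: poweR_le; rewrite ?(ltW s0) ?enorm_ge0//.
  by apply: le_trans (enormD _ _); rewrite /dual_fun linearD linearZ.
rewrite poweRM ?adde_ge0// poweR_EFin.
rewrite /D (mulrC (2 `^ _)%R) -mulrA !EFinM -!muleA -ge0_muleDr; last 2 first.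
- by rewrite !mule_ge0 ?poweR_ge0// EFin_powR_ge0.
- by rewrite !mule_ge0 ?poweR_ge0// EFin_powR_ge0.
rewrite lee_wpmul2l ?EFin_powR_ge0//.
rewrite -ge0_muleDr; last 2 first.
- by rewrite !mule_ge0 ?poweR_ge0// EFin_powR_ge0.
- exact: poweR_ge0.
rewrite -[X in _ * (X * _ + _)]poweR_EFin -poweRM ?EFin_powR_ge0//.
by apply: poweRD_le; rewrite ?(ltW qs0).
Qed.

(** By |f_i(x_j)| <= |f_i| |x_j|, the inner sum at [j] is at most [A] |x_j|^s, where [A] is the sum
    of the |f_i|^s. The outer power makes this [A ^ (q / s)] |x_j|^q, and [r <= s] bounds [A] by the
    [s]-th power of the l_r norm of [f]. *)
Lemma aniso_sum_le f x : lp dual_norm r f ->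
  aniso_sum s q f x <=
  lp_norm dual_norm r f `^ q * \sum_(j <oo) enorm (x j) `^ q.
Proof.
move=> lf; pose A := \sum_(i <oo) dual_norm (f i) `^ s.
have A0 : 0 <= A by apply: nneseries_ge0 => *; exact: poweR_ge0.
have lpr := lp_norm_powR (@dual_norm_ge0 R k X) r0 f.
have A_le : A <= lp_norm dual_norm r f `^ s.
  rewrite -(poweR_div (t := r)) ?gt_eqF// lpr.
  by apply: nneseries_powR_anti => // i; exact: dual_norm_ge0.
(* Finiteness of [A] allows its power to be moved through the series as a real factor. *)
have Aoo : A < +oo by apply: le_lt_trans A_le _; exact: poweR_lty.
have Afin : A \is a fin_num by rewrite ge0_fin_numE.
have Bfin : A `^ (q / s) \is a fin_num by exact: fin_num_poweR.
apply: (@le_trans _ _ (A `^ (q / s) * \sum_(j <oo) enorm (x j) `^ q)); last first.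
  apply: lee_wpmul2r; first by apply: nneseries_ge0 => *; exact: poweR_ge0.
  by rewrite -[leRHS](poweR_div (t := s)) ?gt_eqF// poweR_le// (ltW qs0).
rewrite -(fineK Bfin) -nneseriesZl; last by move=> *; exact: poweR_ge0.
apply: lee_nneseries => [j _ _|j _]; first exact: poweR_ge0.
rewrite -[X in _ <= _ * X](poweR_div (t := s)) ?gt_eqF// fineK//.
rewrite -poweRM ?poweR_ge0//; apply: poweR_le; rewrite ?(ltW qs0)//.
have xfin : enorm (x j) `^ s \is a fin_num by exact: fin_num_poweR.
rewrite muleC -(fineK xfin) -nneseriesZl; last by move=> *; exact: poweR_ge0.
apply: lee_nneseries => [i _ _|i _]; first exact: poweR_ge0.
rewrite fineK// muleC -poweRM ?enorm_ge0 ?dual_norm_ge0//.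
by apply: poweR_le; rewrite ?enorm_ge0 ?(ltW s0)//; exact: enorm_dual_le.
Qed.

Lemma lp_sub_aniso : lp (@enorm R k X) q `<=` aniso s q r.
Proof.
move=> x lx f lf; apply: le_lt_trans (aniso_sum_le x lf) _.
have lf0 : lp_norm dual_norm r f `^ q \is a fin_num.
  by rewrite ge0_fin_numE ?poweR_ge0// poweR_lty.
have xoo : \sum_(j <oo) enorm (x j) `^ q < +oo.
  by rewrite -(lpE (@enorm_ge0 R k X) q0).
exact: lte_mul_pinfty (poweR_ge0 _ _) lf0 xoo.
Qed.

Lemma aniso_norm_le_lp_norm x : aniso_norm s q r x <= lp_norm (@enorm R k X) q x.
Proof.
apply: ge_ereal_sup => _ [f f1 <-].
have lf : lp dual_norm r f by apply: le_lt_trans f1 _; exact: ltry.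
rewrite (lp_normE (@enorm_ge0 R k X) q0).
apply: poweR_le; rewrite ?invr_ge0 ?(ltW q0) ?aniso_sum_ge0//.
apply: le_trans (aniso_sum_le x lf) _; rewrite -[leRHS]mul1e.
apply: lee_wpmul2r; first by apply: nneseries_ge0 => *; exact: poweR_ge0.
by rewrite -(poweR1r q) poweR_le ?(ltW q0)// /lp_norm Lnorm_ge0.
Qed.

(** * The embedding into weakly q-summable sequences *)

Definition dual_single (g : dual X) : nat -> dual X :=
  fun i => if i is 0 then g else dual0.

Lemma lp_norm_single g : lp_norm dual_norm r (dual_single g) = dual_norm g.
Proof.
rewrite (lp_normE (@dual_norm_ge0 R k X) r0).
rewrite nneseries_single; do ?by move=> *; exact: poweR_ge0.
  by rewrite poweRVK ?gt_eqF// dual_norm_ge0.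
by move=> i; rewrite /= dual_norm0 poweR0r// gt_eqF.
Qed.

(** Only the term |g(x_j)|^s survives in the inner sum, and the outer power [q / s] converts its
    exponent to [q]. *)
Lemma aniso_sum_single g x :
  aniso_sum s q (dual_single g) x = \sum_(j <oo) enorm (dual_fun g (x j)) `^ q.
Proof.
apply: eq_eseriesr => j _; rewrite nneseries_single.
- by rewrite poweR_div// gt_eqF.
- by move=> *; exact: poweR_ge0.
- move=> i; rewrite [dual_fun _ _](_ : _ = 0%R)// enorm0 poweR0r//.
  by rewrite gt_eqF.
Qed.

Lemma aniso_sub_weak_lp : @aniso R k X s q r `<=` weak_lp q.
Proof.
move=> x Ax g; rewrite (lpE (@enorm_ge0 R k (scalar_field R k)^o) q0).
rewrite -aniso_sum_single; apply: Ax.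
by rewrite /lp/= lp_norm_single dual_norm_lty.
Qed.

Lemma weak_lp_norm_le_aniso_norm x : weak_lp_norm q x <= aniso_norm s q r x.
Proof.
apply: ge_ereal_sup => _ [g g1 <-]; apply: ereal_sup_ubound.
exists (dual_single g); first by rewrite /= lp_norm_single.
by rewrite aniso_sum_single (lp_normE (@enorm_ge0 R k (scalar_field R k)^o) q0).
Qed.

(** Membership is tested one functional at a time, which reduces the claim to [lp_submod] for scalar
    sequences. *)
Lemma weak_lp_submod : linear_subspace (@weak_lp R k X q).
Proof.
have [z0 lin] := @lp_submod R k (scalar_field R k)^o q q0.
apply: linear_subspaceP.
  move=> g; move: z0 => /set_mem.
  by congr lp; apply/funext => j; rewrite /dual_fun linear0.
move=> c u v wu wv g.
have := lin c (fun j => dual_fun g (u j)) (fun j => dual_fun g (v j)).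
move=> /(_ (mem_set (wu g)) (mem_set (wv g)))/set_mem.
by congr lp; apply/funext => j; rewrite /dual_fun linearD linearZ.
Qed.

(** * Finiteness of the anisotropic norm *)

Lemma aniso_norm_lty x : aniso s q r x -> aniso_norm s q r x < +oo.
Proof.
move=> Ax; rewrite ltNge leye_eq; apply/negP => /eqP xoo.
(* The factor [2 ^ n.+1] compensates the later scaling of the n-th witness, which then still
   contributes at least [n]. *)
have /choice[f fP] : forall n, exists g : nat -> dual X,
    lp_norm dual_norm r g <= 1 /\
    (n * 2 ^ n.+1)%:R%:E <= aniso_sum s q g x `^ q^-1.
  move=> n.
  have : (n * 2 ^ n.+1)%:R%:E < aniso_norm s q r x by rewrite xoo ltry.
  by move=> /ereal_sup_gt[_ [g g1 <-] /ltW ng]; exists g.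
have [e be] := nat_pair_bij.
(* The weight is needed twice: as a scalar [c n] acting on functionals, and as the real number [C n]
   in the estimates. *)
pose c n : scalar_field R k := ((2 ^ n.+1)%:R^-1)%R.
pose C n : R := ((2 ^ n.+1)%:R^-1)%R.
have C0 n : (0 < C n)%R by rewrite invr_gt0 ltr0n expn_gt0.
have C0E n : 0 <= (C n)%:E by rewrite lee_fin ltW.
have cC n : real_part `|c n|%R = C n.
  by rewrite ger0_norm ?invr_ge0// /c /C -(prednK (expn_gt0 2 n.+1)) real_part_natV.
(* The bijection [e] lists the doubly indexed family of scaled functionals as one sequence. *)
pose F m := dual_scale (c (e m).1) (f (e m).1 (e m).2).
have F_norm m : dual_norm (F m) <= (C (e m).1)%:E * dual_norm (f (e m).1 (e m).2).
  by rewrite -cC; exact: dual_norm_scale_le.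
have FE m y :
    enorm (dual_fun (F m) y) = (C (e m).1)%:E * enorm (dual_fun (f (e m).1 (e m).2) y).
  by rewrite -cC -enormZ.
have CE n : C n = ((2 ^ n.+1)%:R^-1)%R by [].
clearbody F C.
have lF : lp dual_norm r F.
  rewrite (lpE (@dual_norm_ge0 R k X) r0).
  apply: (@le_lt_trans _ _ 1%:E); last exact: ltry.
  (* Block [n] contributes at most [C n ^ r], because [f n] lies in the unit ball, and
     [C n ^ r <= C n], because [C n <= 1 <= r]. The resulting geometric series is at most 1. *)
  apply: (@le_trans _ _ (\sum_(n <oo) (1 / (2 ^ n.+1)%:R)%:E)); last first.
    exact: epsilon_trick0.
  apply: (@le_trans _ _ (\sum_(n <oo) \sum_(i <oo)
      ((C n `^ r)%:E * dual_norm (f n i) `^ r))).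
    rewrite -(nneseries_pair (u := fun n i =>
      (C n `^ r)%:E * dual_norm (f n i) `^ r) be); last first.
      by move=> n i; rewrite mule_ge0 ?poweR_ge0// EFin_powR_ge0.
    apply: lee_nneseries => [m _ _|m _]; first exact: poweR_ge0.
    rewrite -poweR_EFin -poweRM ?dual_norm_ge0 ?C0E//.
    by apply: poweR_le; rewrite ?(ltW r0) ?dual_norm_ge0.
  apply: lee_nneseries => [n _ _|n _].
    by apply: nneseries_ge0 => *; rewrite mule_ge0 ?poweR_ge0// EFin_powR_ge0.
  rewrite nneseriesZl; last by move=> *; exact: poweR_ge0.
  have [fn1 _] := fP n; rewrite (lp_norm_le1 (@dual_norm_ge0 R k X) r0) in fn1.
  apply: (@le_trans _ _ ((C n `^ r)%:E * 1)).
    by rewrite lee_wpmul2l// EFin_powR_ge0.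
  rewrite mule1 lee_fin div1r -CE -[leRHS]powRr1 ?(ltW (C0 n))// ger_powR// C0/=.
  by rewrite CE invf_le1 ?ltr0n ?expn_gt0// ler1n expn_gt0.
(* At each [j] the inner sum for [F] contains block [n], so the anisotropic sum of [F] dominates
   that of the scaled [f n]. *)
have sum_ge n : n%:R%:E <= aniso_sum s q F x `^ q^-1.
  have [_ fn] := fP n.
  apply: (@le_trans _ _ ((C n)%:E * aniso_sum s q (f n) x `^ q^-1)).
    apply: le_trans (lee_wpmul2l _ fn); last by rewrite lee_fin ltW.
    by rewrite -EFinM lee_fin natrM mulrC CE mulfK// pnatr_eq0 -lt0n expn_gt0.
  have -> : (C n)%:E = (C n `^ q)%:E `^ q^-1 by rewrite -poweR_EFin poweRVK ?gt_eqF.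
  rewrite -(poweRM _ (EFin_powR_ge0 _ _) (aniso_sum_ge0 _ _)).
  apply: poweR_le; first by rewrite invr_ge0 ltW.
    exact: mule_ge0 (EFin_powR_ge0 _ _) (aniso_sum_ge0 _ _).
  rewrite /aniso_sum -nneseriesZl; last by move=> *; exact: poweR_ge0.
  apply: lee_nneseries => [j _ _|j _].
    exact: mule_ge0 (EFin_powR_ge0 _ _) (poweR_ge0 _ _).
  (* In this form the weight passes under the outer power and then into the inner series. *)
  have -> : (C n `^ q = (C n `^ s) `^ (q / s))%R.
    by rewrite -powRrM mulrCA mulfV ?mulr1// gt_eqF.
  rewrite -[X in X * _]poweR_EFin.
  rewrite -(poweRM _ (EFin_powR_ge0 _ _) (inner_sum_ge0 _ _)).
  apply: poweR_le; first exact: ltW.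
    exact: mule_ge0 (EFin_powR_ge0 _ _) (inner_sum_ge0 _ _).
  rewrite -nneseriesZl; last by move=> *; exact: poweR_ge0.
  pose u m i : \bar R := (C m `^ s)%:E * enorm (dual_fun (f m i) (x j)) `^ s.
  have u0 m i : 0 <= u m i by rewrite mule_ge0 ?poweR_ge0// EFin_powR_ge0.
  have -> : \sum_(m <oo) enorm (dual_fun (F m) (x j)) `^ s =
            \sum_(m <oo) u (e m).1 (e m).2.
    apply: eq_eseriesr => m _; rewrite /u -poweR_EFin -poweRM ?enorm_ge0 ?C0E//.
    by rewrite FE.
  rewrite (@nneseries_pair _ e u be u0).
  (* All blocks except the n-th are discarded. *)
  apply: (@nneseries_term_le _ (fun m => \sum_(i <oo) u m i) n) => m.
  exact: nneseries_ge0.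
have Soo : aniso_sum s q F x `^ q^-1 < +oo by apply: poweR_lty; exact: Ax.
have Sfin : aniso_sum s q F x `^ q^-1 \is a fin_num by rewrite ge0_fin_numE ?poweR_ge0.
(* The root is finite since [F] is in l_r, so some natural number exceeds it, against [sum_ge]. *)
have := archi_boundP (fine_ge0 (poweR_ge0 (aniso_sum s q F x) q^-1)).
by rewrite -lte_fin (fineK Sfin) ltNge sum_ge.
Qed.

End aniso_theory.

(* Assembly of the two embeddings *)
Local Close Scope ereal_scope.
Local Close Scope classical_set_scope.

Theorem proposition2p3 (R : realType) (k : scalars) (s q r : R)
    (hs : 1 <= s) (hq : 1 <= q) (hr : 1 <= r) (hqs : q < s) (hrs : r <= s)
    (X : completeNormedModType (scalar_field R k)) :
  embeds1 (lp (@enorm R k X) q) (lp_norm (@enorm R k X) q)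
    (@aniso R k X s q r) (aniso_norm s q r) /\
  embeds1 (@aniso R k X s q r) (aniso_norm s q r)
    (@weak_lp R k X q) (weak_lp_norm q).
Proof.
have q0 : 0 < q by exact: lt_le_trans hq.
split; split.
- exact: lp_submod.
- exact: aniso_submod.
- exact: lp_sub_aniso.
(* Membership in [lp] is by definition finiteness of [lp_norm]. *)
- by [].
- by move=> x _; exact: aniso_norm_le_lp_norm.
- exact: aniso_submod.
- exact: weak_lp_submod.
- exact: aniso_sub_weak_lp.
- exact: aniso_norm_lty.
- by move=> x _; exact: weak_lp_norm_le_aniso_norm.
Qed.
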